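(* Let $c>0$ be a real number. There exist a finite connected vertex transitive graph $X=(V,E)$ and a set $A\subset V$ with $0<|A|\leqslant\frac12|V|$ such that $$\frac{|\partial A|}{|A|}<\frac{c}{\operatorname{depth}(A)}.$$
   Context: A graph $X=(V,E)$ is vertex transitive if for any $u,v\in V$ there is an automorphism $g$ of $X$ with $g(u)=v$. In a connected graph, $d(u,v)$ denotes the graph distance, and $d(v,B)=\inf\{d(v,u)\mid u\in B\}$ for a non-empty set $B\subset V$. For a non-empty $A\subset V$, $\partial A=\{u\in V\setminus A\mid\{u,v\}\in E\text{ for some }v\in A\}$ and $\operatorname{depth}(A)=\sup\{d(u,V\setminus A)\mid u\in A\}$. $|\cdot|$ denotes the number of vertices. *)

(* Defs.v *)
From mathcomp Require Import all_boot all_order all_fingroup all_algebra.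
From mathcomp Require Import reals.

Set Implicit Arguments.
Unset Strict Implicit.
Unset Printing Implicit Defensive.

(* A finite simple graph is a symmetric irreflexive relation [e] (adjacency)
   on a finite type [V] of vertices. *)

Definition simple_graph (V : finType) (e : rel V) : Prop :=
  symmetric e /\ irreflexive e.

Definition graph_connected (V : finType) (e : rel V) : Prop :=
  forall u v : V, connect e u v.

Definition graph_automorphism (V : finType) (e : rel V) (g : {perm V}) : Prop :=
  forall u v : V, e (g u) (g v) = e u v.

Definition vertex_transitive (V : finType) (e : rel V) : Prop :=
  forall u v : V, exists2 g : {perm V}, graph_automorphism e g & g u = v.

Definition walk_of_length (V : finType) (e : rel V) (n : nat) (u v : V) : bool :=
  [exists p : n.-tuple V, path e u p && (last u p == v)].

(* A minimal walk has length < #|V|, so bounding the range of the minimum loses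
   nothing when [u] and [v] are connected, see [gdistP]; the junk value for
   vertices in different components is #|V|. *)
Definition gdist (V : finType) (e : rel V) (u v : V) : nat :=
  \big[minn/#|V|]_(n < #|V| | walk_of_length e n u v) n.

(* Distances in a connected graph are < #|V|, so the default #|V| is only
   reached when [B] is empty. *)
Definition gdist_set (V : finType) (e : rel V) (v : V) (B : {set V}) : nat :=
  \big[minn/#|V|]_(u in B) gdist e v u.

Definition boundary (V : finType) (e : rel V) (A : {set V}) : {set V} :=
  [set u in ~: A | [exists v in A, e u v]].

Definition depth (V : finType) (e : rel V) (A : {set V}) : nat :=
  \max_(u in A) gdist_set e u (~: A).

Lemma bigmin_le (I : finType) (P : pred I) (F : I -> nat) (m : nat) (i : I) :
  P i -> \big[minn/m]_(j | P j) F j <= F i.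
Proof.
move=> Pi; have := mem_index_enum i; elim: (index_enum I) => //= x s IHs.
rewrite inE big_cons => /predU1P[<-|/IHs le_s]; first by rewrite Pi geq_minl.
by case: ifP => // _; apply: leq_trans (geq_minr _ _) le_s.
Qed.

Lemma bigmin_attained (I : finType) (P : pred I) (F : I -> nat) (m : nat) :
  \big[minn/m]_(j | P j) F j = m \/
  exists2 i, P i & \big[minn/m]_(j | P j) F j = F i.
Proof.
elim/big_ind: _ => [|x y Hx Hy|i Pi]; [by left| |by right; exists i].
by rewrite /minn; case: ifP.
Qed.

Lemma gdistP (V : finType) (e : rel V) (u v : V) : connect e u v ->
  walk_of_length e (gdist e u v) u v /\
  (forall p : seq V, path e u p -> last u p = v -> gdist e u v <= size p).
Proof.
move=> /connectP[p0 Hp0 Hv0].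
have small p : path e u p -> last u p = v ->
  exists2 n : 'I_#|V|, walk_of_length e n u v & n <= size p.
  move=> Hp Hv; have := Hv; case/shortenP: Hp => q Hq Uq sqp Hl.
  have lt_q : size q < #|V| by have := card_uniqP Uq => /= <-; apply: max_card.
  exists (Ordinal lt_q) => /=.
    by apply/existsP; exists (in_tuple q); rewrite /= Hq Hl eqxx.
  by apply: uniq_leq_size sqp; case/andP: Uq.
have le (n : 'I_#|V|) : walk_of_length e n u v -> gdist e u v <= n.
  exact: (@bigmin_le _ (fun n : 'I_#|V| => walk_of_length e n u v)
    (fun n => n : nat)).
split=> [|p Hp Hv]; last by have [n /le H] := small p Hp Hv; apply: leq_trans.
have [n Hn _] := small p0 Hp0 (esym Hv0).
have [E|[i Hi E]] :=
  bigmin_attained (fun n : 'I_#|V| => walk_of_length e n u v)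
    (fun n => n : nat) #|V|.
  by have := le n Hn; rewrite /gdist E leqNgt ltn_ord.
by rewrite /gdist E.
Qed.

(* Main.v *)
Require Import Defs.
From mathcomp Require Import all_boot all_order all_fingroup all_algebra.
From mathcomp Require Import reals.
From mathcomp Require Import zify.
Import Order.TTheory GRing.Theory Num.Theory.
Local Open Scope ring_scope.

(** Blow up every vertex of a long cycle to a clique on [m + 2] vertices, with
    cliques over adjacent vertices completely joined.  Take half of the
    cycle, and remove one vertex from each of its cliques.  Every remaining
    vertex is adjacent to the removed vertex of its clique, so the depth is 1,
    while the boundary consists of one vertex per clique and of the two cliques
    next to the ends of the half cycle. *)

Lemma depth_gt0 (V : finType) (e : rel V) (A : {set V}) :
  graph_connected e -> (0 < #|A|)%N -> (0 < depth e A)%N.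
Proof.
move=> conn_e /card_gt0P[u Au].
apply: leq_trans (leq_bigmax_cond _ Au); rewrite /gdist_set.
(* If [A] is everything, the minimum is the default [#|V|], which is positive because [u] exists.
   Otherwise it is attained at some [v] outside [A], and a walk of length 0 would force [u = v]. *)
have [->|[v nAv ->]] := bigmin_attained (mem (~: A)) (gdist e u) #|V|.
  by apply/card_gt0P; exists u.
have [+ _] := gdistP (conn_e u v); case: (gdist e u v) => // /existsP[p].
by rewrite (tuple0 p) /= => /eqP uv; move: nAv; rewrite !inE -uv Au.
Qed.

Lemma depth_le1 (V : finType) (e : rel V) (A : {set V}) :
  (forall u, u \in A -> exists2 v, v \notin A & e u v) -> (depth e A <= 1)%N.
Proof.
move=> out; apply/bigmax_leqP => u /out[v nAv euv].
have Cv : v \in ~: A by rewrite inE.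
apply: leq_trans (Defs.bigmin_le (gdist e u) #|V| Cv) _.
have [_ le] := gdistP (connect1 euv).
by apply: (le [:: v]) => //=; rewrite euv.
Qed.

(** The second coordinates are subtracted in the ring of integers modulo [n.+2], so the cycle closes
    up by itself. *)
Definition clique_cycle (m n : nat) : rel ('I_m.+2 * 'I_n.+2) :=
  fun u v => (u != v) && (v.2 - u.2 \in [:: 0; 1; -1]).

Definition half_cycle (m n h : nat) : {set 'I_m.+2 * 'I_n.+2} :=
  setX [set~ ord0] [set x : 'I_n.+2 | (x < h)%N].

Lemma clique_cycle_simple (m n : nat) : simple_graph (clique_cycle m n).
Proof.
split=> [u v|u]; last by rewrite /clique_cycle eqxx.
rewrite /clique_cycle eq_sym -(opprB u.2) !inE oppr_eq0 eqr_oppLR eqr_opp.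
by congr (_ && (_ || _)); rewrite orbC.
Qed.

Lemma clique_cycle_connected (m n : nat) :
  graph_connected (clique_cycle m n).
Proof.
move=> u v.
have step (x y : 'I_m.+2 * 'I_n.+2) :
    y.2 - x.2 \in [:: 0; 1; -1] -> connect (clique_cycle m n) x y.
  have [-> //|neq_xy] := eqVneq x y; move=> S.
  by apply: connect1; rewrite /clique_cycle neq_xy.
(* The case [k = 0] moves inside the clique of [u] to the first coordinate of [v]; each further step
   advances by one along the cycle. *)
have walk (k : nat) : connect (clique_cycle m n) u (v.1, u.2 + k%:R).
  elim: k => [|k IHk]; first by apply: step; rewrite /= addr0 subrr inE eqxx.
  apply: connect_trans IHk (step _ _ _).
  by rewrite /= mulrSr addrA [_ + 1]addrC addrK !inE eqxx orbT.
by have := walk (v.2 - u.2); rewrite natr_Zp addrC subrK -surjective_pairing.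
Qed.

(** Adjacency depends only on the difference of the two vertices, so translations of the product
    group are automorphisms. *)
Lemma clique_cycle_transitive (m n : nat) :
  vertex_transitive (clique_cycle m n).
Proof.
move=> u v; exists (perm (addIr (v - u))); last by rewrite permE addrC subrK.
move=> x y; rewrite !permE /clique_cycle (inj_eq (addIr _)) /=.
by rewrite opprD addrACA subrr addr0.
Qed.

Lemma card_ord_lt (n h : nat) : (h <= n)%N ->
  #|[set x : 'I_n | (x < h)%N]| = h.
Proof.
move=> le_hn; rewrite -sum1dep_card (big_ord_narrow le_hn) /=.
by rewrite sum1_card card_ord.
Qed.

Lemma card_half_cycle (m n h : nat) : (h <= n.+2)%N ->
  #|half_cycle m n h| = (m.+1 * h)%N.
Proof. by move=> le_hn; rewrite cardsX cardsC1 card_ord card_ord_lt. Qed.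

Lemma depth_half_cycle (m n h : nat) : (0 < h <= n.+2)%N ->
  depth (clique_cycle m n) (half_cycle m n h) = 1%N.
Proof.
case/andP=> h_gt0 le_hn; apply/eqP; rewrite eqn_leq; apply/andP; split.
  apply: depth_le1 => -[i x]; rewrite !inE /= => /andP[i_neq0 _].
  exists (ord0, x); first by rewrite !inE.
  by rewrite /clique_cycle xpair_eqE (negPf i_neq0) subrr !inE.
apply: depth_gt0; first exact: clique_cycle_connected.
by rewrite card_half_cycle // muln_gt0.
Qed.

Lemma boundary_half_cycle (m n h : nat) : (h <= n.+1)%N ->
  boundary (clique_cycle m n) (half_cycle m n h) \subset
    setX [set ord0] [set x : 'I_n.+2 | (x < h)%N] :|:
    setX setT [set inord h; ord_max].
Proof.
move=> le_hn; apply/subsetP=> -[j y]; rewrite !inE /= => /andP[nAy].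
case/exists_inP=> -[i x]; rewrite !inE /= => /andP[_ lt_xh] /andP[_].
have [lt_yh|le_hy] := ltnP y h.
  by move: nAy; rewrite lt_yh !andbT negbK => ->.
have ltn1 (z : 'I_n.+2) : (z + 1 : 'I_n.+2) = (z.+1 %% n.+2)%N :> nat.
  by rewrite /= modnDmr addn1.
(* Here [y >= h > x]. Difference 0 is impossible; [x = y + 1] must wrap around, so [y] is [ord_max];
   [y = x + 1] cannot wrap, since [x < h <= n.+1], so [y = h]. *)
rewrite /= !inE andbF /= subr_eq0 => /or3P[/eqP eq_xy||].
- by move: le_hy; rewrite -eq_xy leqNgt lt_xh.
- rewrite subr_eq addrC => /eqP eq_x; apply/orP; right.
  have := congr1 (@nat_of_ord _) eq_x; rewrite ltn1 => x_y1; apply/eqP/val_inj => /=.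
  have := ltn_ord y; rewrite ltnS leq_eqVlt => /predU1P[//|lt_y].
  by move: x_y1; rewrite modn_small; lia.
- rewrite -eqr_oppLR opprB subr_eq addrC => /eqP eq_y; apply/orP; left.
  have := congr1 (@nat_of_ord _) eq_y; rewrite ltn1 modn_small; last by lia.
  by move=> y_x1; apply/eqP/val_inj; rewrite /= inordK; lia.
Qed.

Lemma card_boundary_half_cycle (m n h : nat) : (h <= n.+1)%N ->
  (#|boundary (clique_cycle m n) (half_cycle m n h)| <= h + m.+2 * 2)%N.
Proof.
move=> le_hn.
apply: leq_trans (subset_leq_card (boundary_half_cycle m n h le_hn)) _.
apply: leq_trans (leq_card_setU _ _) _; rewrite !cardsX cards1 mul1n.
rewrite (card_ord_lt _ _ (leqW le_hn)) cardsT card_ord leq_add2l leq_mul2l cards2.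
by case: (inord h != ord_max).
Qed.

Theorem corollary3p2 (R : realType) (c : R) (hc : 0 < c) :
  exists (V : finType) (e : rel V),
    simple_graph e /\ graph_connected e /\ vertex_transitive e /\
    exists A : {set V},
      (0 < #|A|)%N /\
      #|A|%:R <= 2^-1 * #|V|%:R :> R /\
      #|boundary e A|%:R / #|A|%:R < c / (depth e A)%:R.
Proof.
(* The cycle has length [n.+2 = 2 * h]. Taking [h] equal to the clique size [m.+2] turns the
   boundary bound into [3 * h], against [m.+1 * h] vertices in the set: the ratio is at most
   [3 / m.+1], and [m] exceeds [3 / c]. *)
pose m := Num.bound (3 / c); pose n := (m.*2).+2; pose h := m.+2.
have le_hn : (h <= n.+1)%N by rewrite /h /n; lia.
have cardA := card_half_cycle m n h (leqW le_hn).
exists ('I_m.+2 * 'I_n.+2)%type, (clique_cycle m n).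
split; first exact: clique_cycle_simple.
split; first exact: clique_cycle_connected.
split; first exact: clique_cycle_transitive.
exists (half_cycle m n h); rewrite cardA depth_half_cycle; last exact: leqW.
split; first by rewrite muln_gt0.
split.
  rewrite ler_pdivlMl // -natrM ler_nat card_prod !card_ord /n /h; nia.
rewrite divr1 ltr_pdivrMr ?ltr0n ?muln_gt0 //.
apply: (@le_lt_trans _ _ (3 * h%:R)).
  rewrite -natrM ler_nat.
  by apply: leq_trans (card_boundary_half_cycle m n h le_hn) _; rewrite /h; lia.
rewrite natrM mulrA ltr_pM2r ?ltr0n // mulrC -ltr_pdivrMr //.
have bound_m : 3 / c < m%:R by rewrite archi_boundP // divr_ge0 // ltW.
by apply: lt_trans bound_m _; rewrite ltr_nat.
Qed.
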